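(* Let $I(m) := -\frac{1+m}{2}\log\frac{1+m}{2} - \frac{1-m}{2}\log\frac{1-m}{2}$ for $m\in(-1,1)$ (with $\log$ the natural logarithm), and let $m_*\in(0,1)$ be defined by $I(m_* )=\frac14$. Then, for every $m\in(-1,1)$ with $|m|>m_*$, there exists $\beta\in \mathrm{AT}_m$ such that $\beta\notin \mathrm{HT}_m$. Here $\mathrm{AT}_m = \{\beta\geq 0: \beta^2(1-m^2)^2\leq 1\}$ and $\mathrm{HT}_m = \big\{\beta\geq 0: \lim_{N\to\infty}\mathbb{E}\,\frac1N\log Z_{N,\beta,m}=0\big\}$, where $Z_{N,\beta,m}$ is the random partition function defined in the context.
   Context: For $N\in\mathbb{N}$, $\beta\geq 0$ and $m\in(-1,1)$, let $(g_{ij})_{1\leq i,j\leq N}$ be i.i.d. (over all ordered pairs $(i,j)$, including $i=j$) centered Gaussian random variables with variance $N^{-1}$, and let $\mathbb{E}$ denote the expectation over these variables. For $\sigma=(\sigma_1,\ldots,\sigma_N)\in\{-1,1\}^N$ set $\widehat\sigma_i:=\sigma_i-m$ and $p_m(\sigma):=\prod_{i=1}^N\frac12(1+m\sigma_i)$. The partition function is $$Z_{N,\beta,m}:=\sum_{\sigma\in\{-1,1\}^N}p_m(\sigma)\exp\bigg(\sum_{1\leq i,j\leq N}\frac{\beta}{\sqrt2}\,g_{ij}\,\widehat\sigma_i\widehat\sigma_j-\frac{\beta^2}{4N}\sum_{1\leq i,j\leq N}\widehat\sigma_i^2\,\widehat\sigma_j^2\bigg).$$ The set $\mathrm{HT}_m$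 (high temperature region) consists of those $\beta\geq0$ for which $\lim_{N\to\infty}\mathbb{E}\,\frac1N\log Z_{N,\beta,m}$ exists and equals $0$. The function $I$ is the binary entropy function; it is strictly decreasing on $[0,1)$ with $I(0)=\log 2$ and $I(m)\to0$ as $m\to1$, so $m_*$ is well defined. *)

(* Defs.v *)
From HB Require Import structures.
From mathcomp Require Import all_boot all_order all_algebra.
From mathcomp Require Import all_classical all_reals all_analysis.

Set Implicit Arguments.
Unset Strict Implicit.
Unset Printing Implicit Defensive.

Import Order.TTheory GRing.Theory Num.Theory.
Import numFieldNormedType.Exports.

Local Open Scope classical_set_scope.
Local Open Scope ring_scope.

Definition mutually_independent (R : realType) (d : measure_display)
    (T : measurableType d) (P : probability T R) (I : finType)
    (X : I -> {RV P >-> R}) : Prop :=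
  forall (J : {set I}) (A : I -> set R),
    (forall i, i \in J -> measurable (A i)) ->
    P (\bigcap_(i in [set` J]) (X i @^-1` A i)) =
      (\prod_(i in J) P (X i @^-1` A i))%E.

(* The second parameter of [normal_prob] is the standard deviation, so the
   variance of each entry is 1/N. *)
Definition gaussian_disorder (R : realType) (d : measure_display)
    (T : measurableType d) (P : probability T R) (N : nat)
    (g : 'I_N -> 'I_N -> {RV P >-> R}) : Prop :=
  (forall (i j : 'I_N) (A : set R), measurable A ->
     distribution P (g i j) A = normal_prob 0 (Num.sqrt N%:R^-1) A) /\
  mutually_independent (fun ij : 'I_N * 'I_N => g ij.1 ij.2).

Section model.
Context {R : realType} {N : nat}.
Implicit Types (m beta : R) (s : {ffun 'I_N -> bool}).

(* [{ffun 'I_N -> bool}] encodes {-1,1}^N: [true] is +1 and [false] is -1. *)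
Definition spin s (i : 'I_N) : R := if s i then 1 else -1.

Definition centered_spin m s (i : 'I_N) : R := spin s i - m.

Definition spin_weight m s : R := \prod_(i < N) ((1 + m * spin s i) / 2).

Definition partition_function beta m (g : 'I_N -> 'I_N -> R) : R :=
  \sum_(s : {ffun 'I_N -> bool})
    spin_weight m s *
    expR (\sum_(i < N) \sum_(j < N)
            beta / Num.sqrt 2 * g i j * centered_spin m s i * centered_spin m s j
          - beta ^+ 2 / (4 * N%:R) *
            \sum_(i < N) \sum_(j < N)
              centered_spin m s i ^+ 2 * centered_spin m s j ^+ 2).

End model.

Definition mean_free_energy (R : realType) (d : measure_display)
    (T : measurableType d) (P : probability T R) (N : nat)
    (g : 'I_N -> 'I_N -> {RV P >-> R}) (beta m : R) : \bar R :=
  'E_P[fun w => N%:R^-1 * ln (partition_function beta m (fun i j => g i j w))].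

Definition HT (R : realType) (d : measure_display) (T : measurableType d)
    (P : probability T R) (g : forall N : nat, 'I_N -> 'I_N -> {RV P >-> R})
    (m : R) : set R :=
  [set beta | 0 <= beta /\
     (fun N : nat => mean_free_energy (g N) beta m) @ \oo --> 0%E].

Definition AT (R : realType) (m : R) : set R :=
  [set beta | 0 <= beta /\ beta ^+ 2 * (1 - m ^+ 2) ^+ 2 <= 1].

Definition binary_entropy (R : realType) (m : R) : R :=
  - ((1 + m) / 2 * ln ((1 + m) / 2)) - (1 - m) / 2 * ln ((1 - m) / 2).

(* Main.v *)
Require Import Defs.
From HB Require Import structures.
From mathcomp Require Import all_boot all_order all_algebra.
From mathcomp Require Import all_classical all_reals all_analysis.
From mathcomp Require Import measurable_realfun ring lra.

Import Order.TTheory GRing.Theory Num.Theory.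
Import numFieldNormedType.Exports.

Local Open Scope classical_set_scope.
Local Open Scope ring_scope.

(* Take [beta = (1 - m^2)^-1], the boundary of the AT region. For [th] in (0,1),
   subadditivity of [x |-> x^th] and Gaussian moments give
     E (Z^th) <= sum_s p(s)^th exp (- th (1 - th) v(s) / 2),
   where [v(s)] is the variance of the Hamiltonian at [s], a convex quadratic
   function of [sum_i (s_i - m)^2]. Replacing it by its tangent at the typical
   value [N (1 - m^2)] makes the right-hand side a product over sites, [phi(th)^N],
   so [E (ln Z) / N <= ln (phi th) / th] for every [N >= 1]. Now [phi 1 = 1] and
   [phi' 1 = 1/4 - I(m)], which is positive for [|m| > m_*]; hence [phi th < 1] for
   some [th < 1], and the free energy stays below a negative constant. *)

(** * Change of measure and exponential moments of a normal law *)

Section change_of_measure.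
Context {d d' : measure_display} {T : measurableType d} {T' : measurableType d'}
  {R : realType}.
Local Open Scope ereal_scope.
Import HBNNSimple.

(** The hypothesis is the case of indicators; linearity gives simple functions, and monotone
    convergence on both sides gives nonnegative [f]. It serves both for densities ([X = id]) and for
    independence ([g] a product of the other variables). *)
Lemma ge0_integral_density (mu : {measure set T -> \bar R})
    (nu : {measure set T' -> \bar R}) (X : T -> T') (g : T -> R) (f : T' -> R) :
  measurable_fun setT X -> measurable_fun setT g -> (forall x, 0 <= g x)%R ->
  measurable_fun setT f -> (forall y, 0 <= f y)%R ->
  (forall A, measurable A -> nu A = \int[mu]_x (\1_A (X x) * g x)%:E) ->
  \int[nu]_y (f y)%:E = \int[mu]_x (f (X x) * g x)%:E.
Proof.
move=> mX mg g0 mf f0 nuE.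
have mfE : measurable_fun setT (EFin \o f) by exact/measurable_EFinP.
have f0E y : setT y -> 0 <= (f y)%:E by rewrite lee_fin f0.
pose h := nnsfun_approx measurableT mfE.
have hf y : ((h n y)%:E @[n --> \oo] --> (f y)%:E)%classic.
  exact: (@cvg_nnsfun_approx _ _ _ _ measurableT _ mfE f0E).
have mhX (k : {nnsfun T' >-> R}) : measurable_fun setT (fun x => k (X x)).
  exact: measurableT_comp.
have simpleE (k : {nnsfun T' >-> R}) :
    \int[nu]_y (k y)%:E = \int[mu]_x (k (X x) * g x)%:E.
  rewrite integralT_nnsfun sintegralE/=.
  have kE x : (k (X x) * g x)%:E =
      \sum_(r \in range k) (r * (\1_(k @^-1` [set r]) (X x) * g x))%:E.
    rewrite fsumEFin//; congr EFin; rewrite fimfunE mulr_fsuml//.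
    by apply: eq_fsbigr => r _; rewrite mulrA.
  under [RHS]eq_integral do rewrite kE.
  rewrite ge0_integral_fsum//; last 2 first.
  - move=> r; apply/measurable_EFinP/measurable_funM => //.
    apply: measurable_funM => //.
    exact: (measurableT_comp (measurable_indic _)).
  - move=> r x _ ; rewrite mulrA EFinM mule_ge0 ?lee_fin//.
    exact: nnfun_muleindic_ge0.
  rewrite fsbig_mkcond/= [RHS]fsbig_mkcond/=.
  (* Only values [r = k y] remain; they are nonnegative, so they can be pulled out of the
     integral. *)
  apply: eq_fsbigr => r _; rewrite /patch; case: ifPn => //; rewrite inE => -[y _ <-].
  under [RHS]eq_integral do rewrite EFinM.
  rewrite ge0_integralZl//.
  - by rewrite -nuE.
  - apply/measurable_EFinP/measurable_funM => //.
    exact: (measurableT_comp (measurable_indic _)).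
  - by move=> x _; rewrite lee_fin mulr_ge0.
  - by rewrite lee_fin.
transitivity (limn (fun n => \int[nu]_y (h n y)%:E)).
  rewrite -monotone_convergence//=.
  - by apply: eq_integral => y _; apply/esym/cvg_lim => //; exact: hf.
  - by move=> n; apply/measurable_EFinP.
  - by move=> n y _; rewrite lee_fin.
  - by move=> y _ a b ab; rewrite lee_fin; exact/lefP/nd_nnsfun_approx.
transitivity (limn (fun n => \int[mu]_x (h n (X x) * g x)%:E)).
  by congr (limn _); apply/funext => n; exact: simpleE.
rewrite -monotone_convergence//=.
- apply: eq_integral => x _; apply/cvg_lim => //.
  under eq_fun do rewrite EFinM.
  by rewrite EFinM; apply: cvgeZr => //; exact: hf.
- by move=> n; apply/measurable_EFinP/measurable_funM.
- by move=> n x _; rewrite lee_fin mulr_ge0.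
- move=> x _ a b ab; rewrite lee_fin ler_wpM2r//.
  exact/lefP/nd_nnsfun_approx.
Qed.

End change_of_measure.

(* [nu] is kept abstract because the structure on [R] over which [normal_prob] is
   a library measure differs from that of the codomain of a random variable. *)
Lemma normal_mgf (R : realType) (nu : {measure set R -> \bar R}) (s : R) :
  s != 0 -> (forall A : set R, measurable A -> nu A = normal_prob 0 s A) ->
  forall t, (\int[nu]_x (expR (t * x))%:E = (expR (s ^+ 2 * t ^+ 2 / 2))%:E)%E.
Proof.
move=> s0 nuE t.
rewrite (@ge0_integral_density _ _ _ _ R lebesgue_measure nu id
  (normal_pdf 0 s)) //=; first last.
- move=> A mA; rewrite nuE// /normal_prob integral_mkcond; apply: eq_integral => x _.
  by rewrite /patch indicE; case: ifP; rewrite ?mul1r ?mul0r.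
- by apply: measurableT_comp => //; exact: measurable_funM.
- by move=> x; exact: normal_pdf_ge0.
- exact: measurable_normal_pdf.
(* Completing the square: the exponential tilt moves the mean to [s ^+ 2 * t]. *)
have shift x : (expR (t * x) * normal_pdf 0 s x)%:E =
    ((expR (s ^+ 2 * t ^+ 2 / 2))%:E * (normal_pdf (s ^+ 2 * t) s x)%:E)%E.
  rewrite -EFinM !normal_pdfE//= /normal_fun; congr EFin.
  rewrite mulrCA [RHS]mulrCA -!expRD; congr (_ * expR _).
  by field.
under eq_integral do rewrite shift.
rewrite ge0_integralZl//.
- by rewrite integral_normal_pdf mule1.
- by apply/measurable_EFinP; exact: measurable_normal_pdf.
- by move=> x _; rewrite lee_fin normal_pdf_ge0.
Qed.

(** * Expectations of products of independent variables *)

Section independence.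
Context {R : realType} {d : measure_display} {T : measurableType d}
  (P : probability T R) {I : finType} (X : I -> {RV P >-> R}).

(** Indicators are turned into general functions one index at a time: the induction runs over a list
    outside which every [h i] is an indicator. For the empty list this is the definition of
    independence. *)
Lemma integral_prod_mutually_independent (h : I -> R -> R) (e : I -> R) :
  mutually_independent X ->
  (forall i, measurable_fun setT (h i)) -> (forall i x, 0 <= h i x) ->
  (forall i, \int[P]_w (h i (X i w))%:E = (e i)%:E)%E ->
  (\int[P]_w (\prod_i h i (X i w))%:E = (\prod_i e i)%:E)%E.
Proof.
move=> indX.
have : forall i, i \notin enum I -> exists2 A, measurable A & h i = \1_A.
  by move=> i; rewrite mem_enum.
elim: (enum I) h e => [|j s IH] h e hind mh h0 he.
  have /choice[A hA] : forall i, exists A, measurable A /\ h i = \1_A.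
    by move=> i; have [//|A mA ->] := hind i; exists A.
  have prodE w : \prod_i h i (X i w) =
      \1_(\bigcap_(i in [set` [set: I]%SET]) (X i @^-1` A i)) w.
    rewrite indicE; case: (boolP (w \in _)) => [|/negP]; rewrite inE => wA.
      rewrite big1// => i _; rewrite (hA i).2 indicE mem_set//.
      by apply: wA => /=; rewrite inE.
    have /existsNP[i wAi] : ~ forall i, (X i @^-1` A i) w.
      by move=> wA'; apply: wA => i _; exact: wA'.
    by rewrite (bigD1 i)//= (hA i).2 indicE memNset// mul0r.
  under eq_integral do rewrite prodE.
  have mXA i : measurable (X i @^-1` A i).
    by rewrite -[X in measurable X]setTI; apply: measurable_funP => //; exact: (hA i).1.
  rewrite integral_indic//; last first.
    by apply: fin_bigcap_measurable => // i _.
  rewrite setIT; apply: (eq_trans (indX [set: I]%SET A _)) => [i _|].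
    exact: (hA i).1.
  rewrite -prodEFin; apply: eq_big => [i|i _]; first by rewrite inE.
  rewrite -he (hA i).2.
  by rewrite (_ : (fun w => _) = fun w => (\1_(X i @^-1` A i) w)%:E)//
    integral_indic// setIT.
pose g w := \prod_(i | i != j) h i (X i w).
have g0 w : 0 <= g w by apply: prodr_ge0.
have mhX i : measurable_fun setT (fun w => h i (X i w)).
  exact: measurableT_comp.
have mg : measurable_fun setT g.
  rewrite /g; under eq_fun do rewrite -big_filter.
  by apply: measurable_prod => i _.
have e0 i : 0 <= e i.
  by rewrite -lee_fin -he; apply: integral_ge0 => w _; rewrite lee_fin.
have c0 : 0 <= \prod_(i | i != j) e i by apply: prodr_ge0.
(* The induction hypothesis, with [h j] replaced by [\1_A], says that weighting by [g] only rescales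
   the law of [X j]. *)
pose nu := mscale (NngNum c0) (distribution P (X j)).
have nuE A : measurable A -> (nu A = \int[P]_w (\1_A (X j w) * g w)%:E)%E.
  move=> mA.
  have mXA : measurable (X j @^-1` A).
    by rewrite -[X in measurable X]setTI; exact: measurable_funP.
  pose h' i := if i == j then \1_A else h i.
  pose e' i := if i == j then fine (P (X j @^-1` A)) else e i.
  transitivity (\int[P]_w (\prod_i h' i (X i w))%:E)%E; last first.
    apply: eq_integral => w _; rewrite (bigD1 j)//= {1}/h' eqxx; congr (_ * _)%:E.
    by apply: eq_bigr => i /negbTE ij; rewrite /h' ij.
  rewrite (IH h' e').
  - rewrite (bigD1 j)//= {1}/e' eqxx /nu /mscale/= mulrC EFinM.
    rewrite fineK ?fin_num_measure//; congr ((_)%:E * _)%E.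
    by apply: eq_bigr => i /negbTE ij; rewrite /e' ij.
  - move=> i nis; rewrite /h'; case: eqVneq => [_|ij]; first by exists A.
    by apply: hind; rewrite inE negb_or ij.
  - by move=> i; rewrite /h'; case: ifP.
  - by move=> i x; rewrite /h'; case: ifP.
  - move=> i; rewrite /h' /e'; case: eqVneq => [->|//].
    rewrite (_ : (fun w => _) = fun w => (\1_(X j @^-1` A) w)%:E)//.
    by rewrite integral_indic// setIT fineK// fin_num_measure.
transitivity (\int[nu]_x (h j x)%:E)%E.
  rewrite (@ge0_integral_density _ _ _ _ R P nu (X j) g)//.
  by apply: eq_integral => w _; rewrite (bigD1 j).
rewrite ge0_integral_mscale//=; last 2 first.
- by apply/measurable_EFinP.
- by move=> x _; rewrite lee_fin.
rewrite ge0_integral_distribution//; last 2 first.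
- exact/measurable_EFinP.
- by move=> x; rewrite lee_fin.
by rewrite /= he -EFinM [in RHS](bigD1 j)//= mulrC.
Qed.

End independence.

(** * Upper bounds of integrals by domination *)

Section integral_upper_bound.
Context {d : measure_display} {T : measurableType d} {R : realType}.
Local Open Scope ereal_scope.

(* [f] itself need not be integrable: its integral may then be [-oo]. *)
Lemma le_integral_of_integrable (mu : {measure set T -> \bar R}) (f h : T -> \bar R) :
  measurable_fun setT f -> mu.-integrable setT h -> (forall x, f x <= h x) ->
  \int[mu]_x f x <= \int[mu]_x h x.
Proof.
move=> mf /measurable_int mh fh; rewrite integralE [leRHS]integralE.
apply: leeB; apply: ge0_le_integral => //.
- exact: measurable_funepos.
- exact: measurable_funepos.
- by move=> x _; rewrite !funeposE le_max2.
- exact: measurable_funeneg.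
- exact: measurable_funeneg.
- by move=> x _; rewrite !funenegE le_max2// leeN2.
Qed.

Lemma integral_le_addr (P : probability T R) (f F : T -> R) (a b : R) :
  measurable_fun setT f -> measurable_fun setT F -> (forall x, 0 <= F x)%R ->
  \int[P]_x (F x)%:E <= a%:E -> (forall x, f x <= F x + b)%R ->
  \int[P]_x (f x)%:E <= (a + b)%:E.
Proof.
move=> mf mF F0 Fa fF.
have iF : P.-integrable setT (EFin \o F).
  apply/integrableP; split; first exact/measurable_EFinP.
  under eq_integral do rewrite /= ger0_norm//.
  exact: (le_lt_trans Fa (ltry _)).
have ib : P.-integrable setT (EFin \o cst b) by exact: finite_measure_integrable_cst.
apply: (@le_trans _ _ (\int[P]_x ((EFin \o F) x + (EFin \o cst b) x))).
  apply: le_integral_of_integrable => //.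
  - exact/measurable_EFinP.
  - exact: integrableD.
rewrite integralD//= integral_cst//= probability_setT mule1 EFinD.
exact: leeD2r.
Qed.

End integral_upper_bound.

(** * Exponential moments of the disorder *)

Section gaussian.
Context {R : realType} {d : measure_display} {T : measurableType d}
  (P : probability T R).

Lemma gaussian_disorder_mgf (N : nat) (g : 'I_N -> 'I_N -> {RV P >-> R})
    (t : 'I_N -> 'I_N -> R) : (0 < N)%N -> gaussian_disorder g ->
  (\int[P]_w (expR (\sum_i \sum_j t i j * g i j w))%:E =
   (expR (\sum_i \sum_j t i j ^+ 2 / (2 * N%:R)))%:E)%E.
Proof.
move=> N0 [gdist gind].
have sN0 : Num.sqrt N%:R^-1 != 0 :> R.
  by rewrite gt_eqF// sqrtr_gt0 invr_gt0 ltr0n.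
pose h (ij : 'I_N * 'I_N) x := expR (t ij.1 ij.2 * x).
pose e (ij : 'I_N * 'I_N) := expR (t ij.1 ij.2 ^+ 2 / (2 * N%:R)).
have mh ij : measurable_fun setT (h ij).
  by apply: measurableT_comp => //; exact: measurable_funM.
have := @integral_prod_mutually_independent _ _ _ P _
  (fun ij => g ij.1 ij.2) h e gind mh.
rewrite /h /e => prodE.
under eq_integral do rewrite pair_bigA/= expR_sum.
rewrite pair_bigA/= expR_sum; apply: prodE => [ij x|[i j]/=]; first exact: expR_ge0.
transitivity (\int[distribution P (g i j)]_x (expR (t i j * x))%:E)%E.
  rewrite ge0_integral_distribution//.
  by apply/measurable_EFinP; exact: (mh (i, j)).
rewrite (@normal_mgf _ _ _ sN0 (gdist i j)) sqr_sqrtr ?invr_ge0//; congr (expR _)%:E.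
by field; rewrite pnatr_eq0 -lt0n.
Qed.

End gaussian.

(** * Logarithm of a sum and fractional moments *)

Section fractional_moment.
Context {R : realType}.

(** Subadditivity of the power [th], followed by the tangent bound [ln y <= y / c + ln c - 1]. The
    result is linear in the fractional sum, so expectations can be taken directly. *)
Lemma ln_sum_expR_le (I : finType) (i0 : I) (L : I -> R) (th c : R) :
  0 < th <= 1 -> 0 < c ->
  ln (\sum_i expR (L i)) <= th^-1 * ((\sum_i expR (th * L i)) / c + (ln c - 1)).
Proof.
move=> /andP[th0 th1] c0; set Z := \sum_i _; set u := ln Z.
have Z0 : 0 < Z.
  rewrite /Z (bigD1 i0)//= ltr_pwDl ?expR_gt0//.
  by apply: sumr_ge0 => i _; exact: expR_ge0.
have Zu : expR u = Z by rewrite /u lnK.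
have Lu i : L i <= u.
  rewrite -ler_expR Zu /Z (bigD1 i)//= lerDl.
  by apply: sumr_ge0 => j _; exact: expR_ge0.
have frac : expR (th * u) <= \sum_i expR (th * L i).
  have -> : expR (th * u) = \sum_i expR (L i + (th - 1) * u).
    under eq_bigr do rewrite expRD.
    by rewrite -mulr_suml -/Z -Zu -expRD; congr expR; ring.
  (* Termwise comparison: it holds because each [L i] is at most [u]. *)
  apply: ler_sum => i _; rewrite ler_expR.
  rewrite -subr_ge0 (_ : _ - _ = (1 - th) * (u - L i)); last by ring.
  by rewrite mulr_ge0// subr_ge0.
rewrite mulrC ler_pdivlMr// mulrC.
have := expR_ge1Dx (th * u - ln c).
rewrite expRD expRN lnK// => e1.
have : expR (th * u) / c <= (\sum_i expR (th * L i)) / c by rewrite ler_pM2r ?invr_gt0.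
by lra.
Qed.

End fractional_moment.

(** * Monotonicity of the binary entropy *)

Section entropy.
Context {R : realType}.
Implicit Types a b m : R.

Lemma mul_ln_ratio_le (x y : R) : 0 < x -> 0 < y -> x * (ln y - ln x) <= y - x.
Proof.
move=> x0 y0; rewrite -ln_div// mulrC -ler_pdivlMr//.
rewrite mulrBl divff ?gt_eqF// -[X in ln X](subrK 1) addrC.
by rewrite le_ln1Dx// ltrBrDr addrC subrr divr_gt0.
Qed.

Lemma binary_entropyN m : binary_entropy (- m) = binary_entropy m.
Proof. by rewrite /binary_entropy opprK; ring. Qed.

(* By Gibbs' inequality [binary_entropy b] is at most the cross entropy relative
   to [a], which is affine in [b] and equals [binary_entropy a] at [b = a]. *)
Lemma binary_entropy_decreasing a b :
  0 < a -> a < b -> b < 1 -> binary_entropy b < binary_entropy a.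
Proof.
move=> a0 ab b1; rewrite /binary_entropy.
have p0 : 0 < (1 + b) / 2 by lra.
have q0 : 0 < (1 - b) / 2 by lra.
have p'0 : 0 < (1 + a) / 2 by lra.
have q'0 : 0 < (1 - a) / 2 by lra.
have gp := mul_ln_ratio_le _ _ p0 p'0.
have gq := mul_ln_ratio_le _ _ q0 q'0.
(* Half of this gap is minus the slope in [b] of the cross entropy, whence strictness. *)
have : ln ((1 - a) / 2) < ln ((1 + a) / 2) by rewrite ltr_ln//; lra.
move: gp gq; set A := ln _; set B := ln _; set C := ln _; set D := ln _.
by nra.
Qed.

End entropy.

(** * The one-site sum for exponents near 1 *)

Section single_site.
Context {R : realType}.
Implicit Types (m th : R) (b : bool).

Definition ising b : R := if b then 1 else -1.

(** With [x = (ising b - m) ^+ 2 / (1 - m ^+ 2)], the factor [2 * x - 1] is the tangent of [x ^+ 2]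
    at [x = 1]. *)
Definition site_exponent m th b : R :=
  th * ln ((1 + m * ising b) / 2) -
  th * (1 - th) / 4 * (2 * (ising b - m) ^+ 2 / (1 - m ^+ 2) - 1).

(* This is [phi th] in the argument above. *)
Definition site_sum m th : R := \sum_b expR (site_exponent m th b).

Lemma site_sum_gt0 m th : 0 < site_sum m th.
Proof. by rewrite /site_sum big_bool addr_gt0// expR_gt0. Qed.

(** From [expR y <= (1 - y)^-1] and [(1 + y + 2 * y ^+ 2) * (1 - y) = 1 + y ^+ 2 * (1 - 2 * y)]. *)
Lemma expR_le_quadratic (y : R) : y <= 2^-1 -> expR y <= 1 + y + 2 * y ^+ 2.
Proof.
move=> y2; have y1 : 0 < 1 - y by lra.
have : expR y <= (1 - y)^-1.
  by rewrite -[expR y]invrK -expRN lef_pV2 ?posrE ?expR_gt0// expR_ge1Dx.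
move=> /le_trans; apply.
rewrite -[leLHS]mul1r ler_pdivrMr//.
by have := sqr_ge0 y; nra.
Qed.

(* The left derivative of [site_sum m] at [1] is [4^-1 - binary_entropy m]. *)
Lemma site_sum_lt1 m : -1 < m < 1 -> binary_entropy m < 4^-1 ->
  exists2 th, 0 < th < 1 & site_sum m th < 1.
Proof.
move=> /andP[m0 m1] I4.
have q0 : 0 < 1 - m ^+ 2 by nra.
set kp := 2 * (1 - m) ^+ 2 / (1 - m ^+ 2) - 1.
set km := 2 * (-1 - m) ^+ 2 / (1 - m ^+ 2) - 1.
set lp := ln ((1 + m * 1) / 2); set lm := ln ((1 + m * -1) / 2).
set p := (1 + m) / 2; set q := (1 - m) / 2.
have p0 : 0 < p by rewrite /p; lra.
have r0 : 0 < q by rewrite /q; lra.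
have pq1 : p + q = 1 by rewrite /p /q; field.
(* The centered spin has variance [1 - m ^+ 2] under the weights [p], [q]. *)
have k1 : p * kp + q * km = 1 by rewrite /p /q /kp /km; field; rewrite gt_eqF.
have IE : binary_entropy m = - (p * lp) - q * lm.
  by rewrite /binary_entropy /lp /lm mulr1 mulrN1.
set A := `|lp| + `|lm| + `|kp| + `|km| + 1.
have A1 : 1 <= A by rewrite /A lerDr !addr_ge0.
set dl := 4^-1 - binary_entropy m.
have dl0 : 0 < dl by rewrite subr_gt0.
(* [B] collects the second-order terms: the sum at [th = 1 - ep] will be at most
   [1 + ep * (ep * B - dl)]. The three summands in [D] ensure [ep < 1], [ep * A <= 2^-1] and
   [ep * B < dl]. *)
set B := 4^-1 + 2 * A ^+ 2.
set D := dl * (1 + 2 * A) + B.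
have B0 : 0 < B by rewrite /B; nra.
have D0 : 0 < D by rewrite /D; nra.
set ep := dl / D.
have ep0 : 0 < ep by rewrite divr_gt0.
have ep1 : ep < 1 by rewrite /ep ltr_pdivrMr// /D; nra.
have epA : ep * A <= 2^-1 by rewrite /ep mulrAC ler_pdivrMr// /D; nra.
have epB : ep * B < dl.
  by rewrite /ep mulrAC ltr_pdivrMr// /D ltr_pM2l//; nra.
exists (1 - ep); first lra.
pose a (l k : R) := - l - (1 - ep) / 4 * k.
have aA l k : `|l| + `|k| <= A -> `|a l k| <= A.
  move=> lkA; apply: le_trans lkA; apply: (le_trans (ler_normB _ _)).
  rewrite normrN lerD2l normrM ler_piMl//.
  by rewrite ger0_norm; lra.
have site l k x : 0 < x -> l = ln x -> `|l| + `|k| <= A ->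
    expR ((1 - ep) * l - (1 - ep) * (1 - (1 - ep)) / 4 * k) <=
    x * (1 + ep * a l k + 2 * ep ^+ 2 * A ^+ 2).
  move=> x0 lx /aA alk.
  have -> : (1 - ep) * l - (1 - ep) * (1 - (1 - ep)) / 4 * k = l + ep * a l k.
    by rewrite /a; field.
  rewrite expRD {1}lx lnK// ler_pM2l//.
  have [a1 a2] : - A <= a l k /\ a l k <= A by apply/andP; rewrite -ler_norml.
  apply: (le_trans (expR_le_quadratic _ _)); first by nra.
  rewrite lerD2l exprMn -mulrA ler_pM2l// ler_pM2l ?exprn_gt0//.
  by rewrite -real_normK ?num_real// lerXn2r// nnegrE (le_trans _ A1).
have sp : expR (site_exponent m (1 - ep) true) <=
    p * (1 + ep * a lp kp + 2 * ep ^+ 2 * A ^+ 2).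
  apply: site => //; first by rewrite /lp mulr1.
  by rewrite /A; have := normr_ge0 lm; have := normr_ge0 km; lra.
have sm : expR (site_exponent m (1 - ep) false) <=
    q * (1 + ep * a lm km + 2 * ep ^+ 2 * A ^+ 2).
  apply: site => //; first by rewrite /lm mulrN1.
  by rewrite /A; have := normr_ge0 lp; have := normr_ge0 kp; lra.
rewrite /site_sum big_bool/=; apply: (le_lt_trans (lerD sp sm)).
have -> : p * (1 + ep * a lp kp + 2 * ep ^+ 2 * A ^+ 2) +
    q * (1 + ep * a lm km + 2 * ep ^+ 2 * A ^+ 2) =
    (p + q) * (1 + 2 * ep ^+ 2 * A ^+ 2) +
    ep * ((- (p * lp) - q * lm) - (1 - ep) / 4 * (p * kp + q * km)).
  by rewrite /a; field.
rewrite pq1 k1 -IE mul1r mulr1 -addrA gtrDl.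
have -> : 2 * ep ^+ 2 * A ^+ 2 + ep * (binary_entropy m - (1 - ep) / 4) =
    ep * (ep * B - dl) by rewrite /B /dl; field.
by rewrite pmulr_rlt0// subr_lt0.
Qed.

End single_site.

(** * The mean free energy at fixed size *)

Section free_energy.
Context {R : realType} {d : measure_display} {T : measurableType d}
  (P : probability T R).

Section fixed_size.
Variables (N : nat) (g : 'I_N -> 'I_N -> {RV P >-> R}) (m : R).
Hypotheses (N0 : (0 < N)%N) (hg : gaussian_disorder g) (hm : -1 < m < 1).
Let beta := (1 - m ^+ 2)^-1.
Implicit Types s : {ffun 'I_N -> bool}.

Let S s := \sum_(i < N) centered_spin m s i ^+ 2.

Let log_gibbs s w :=
  \sum_(i < N) ln ((1 + m * spin s i) / 2) +
  (\sum_(i < N) \sum_(j < N)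
     beta / Num.sqrt 2 * g i j w * centered_spin m s i * centered_spin m s j -
   beta ^+ 2 / (4 * N%:R) * S s ^+ 2).

Let sum_sqr s :
  \sum_(i < N) \sum_(j < N) centered_spin m s i ^+ 2 * centered_spin m s j ^+ 2 =
  S s ^+ 2.
Proof. by rewrite expr2 big_distrlr. Qed.

Let partition_functionE w :
  partition_function beta m (fun i j => g i j w) = \sum_s expR (log_gibbs s w).
Proof.
apply: eq_bigr => s _; rewrite sum_sqr /log_gibbs [RHS]expRD; congr (_ * _).
rewrite /spin_weight expR_sum; apply: eq_bigr => i _.
by rewrite lnK// posrE /spin; case: ifP => _; move: hm => /andP[]; lra.
Qed.

Let measurable_log_gibbs s : measurable_fun setT (log_gibbs s).
Proof.
apply: measurable_funD => //; apply: measurable_funB => //.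
apply: measurable_sum => i; apply: measurable_sum => j.
by do 2 apply: measurable_funM => //; apply: measurable_funM.
Qed.

(* The variance of the Hamiltonian is a convex function of [S s], hence bounded
   below by its tangent at the typical value [N * (1 - m ^+ 2)]. The tangent is a
   sum over sites, so the resulting bound factorizes. *)
Let moment_log_gibbs_le s (th : R) : 0 <= th <= 1 ->
  (\int[P]_w (expR (th * log_gibbs s w))%:E <=
   (\prod_i expR (site_exponent m th (s i)))%:E)%E.
Proof.
move=> /andP[th0 th1].
have q0 : 0 < 1 - m ^+ 2 by move: hm => /andP[]; nra.
have n0 : 0 < N%:R :> R by rewrite ltr0n.
pose t i j := th * beta / Num.sqrt 2 * centered_spin m s i * centered_spin m s j.
pose K := th * \sum_(i < N) ln ((1 + m * spin s i) / 2) -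
  th * (beta ^+ 2 / (4 * N%:R) * S s ^+ 2).
have tE w : (expR (th * log_gibbs s w))%:E =
    ((expR K)%:E * (expR (\sum_i \sum_j t i j * g i j w))%:E)%E.
  rewrite -EFinM -expRD; congr (expR _)%:E.
  rewrite /log_gibbs /K mulrDr mulrBr -!addrA; congr (_ + _).
  rewrite addrC; congr (_ + _); rewrite mulr_sumr; apply: eq_bigr => i _.
  by rewrite mulr_sumr; apply: eq_bigr => j _; rewrite /t; ring.
under eq_integral do rewrite tE.
rewrite ge0_integralZl//; last first.
- apply/measurable_EFinP; apply: measurableT_comp => //.
  apply: measurable_sum => i; apply: measurable_sum => j.
  exact: measurable_funM.
rewrite (@gaussian_disorder_mgf _ _ _ _ _ _ _ N0 hg) -EFinM lee_fin.
rewrite -expR_sum -expRD ler_expR.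
have -> : \sum_i \sum_j t i j ^+ 2 / (2 * N%:R) =
    th ^+ 2 * beta ^+ 2 / (4 * N%:R) * S s ^+ 2.
  rewrite -sum_sqr mulr_sumr; apply: eq_bigr => i _.
  rewrite mulr_sumr; apply: eq_bigr => j _.
  rewrite /t !exprMn (_ : (Num.sqrt 2)^-1 ^+ 2 = 2^-1 :> R) ?exprVn ?sqr_sqrtr//.
  by field; rewrite !gt_eqF.
have -> : \sum_i site_exponent m th (s i) =
    th * \sum_(i < N) ln ((1 + m * spin s i) / 2) -
    th * (1 - th) / 4 * (2 * S s / (1 - m ^+ 2) - N%:R).
  rewrite /site_exponent sumrB -mulr_sumr; congr (_ - _).
  rewrite -mulr_sumr sumrB -mulr_suml -mulr_sumr; congr (_ * (_ - _)).
  by rewrite sumr_const card_ord.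
rewrite /K -addrA lerD2l -subr_ge0.
have -> : forall x, - (th * (1 - th) / 4 * (2 * S s / (1 - m ^+ 2) - N%:R)) - x =
   - x - th * (1 - th) / 4 * (2 * S s / (1 - m ^+ 2) - N%:R) by move=> x; ring.
(* The gap between the parabola and its tangent is a perfect square, by the choice of [beta]. *)
have -> : - (- (th * (beta ^+ 2 / (4 * N%:R) * S s ^+ 2)) +
    th ^+ 2 * beta ^+ 2 / (4 * N%:R) * S s ^+ 2) -
    th * (1 - th) / 4 * (2 * S s / (1 - m ^+ 2) - N%:R) =
    th * (1 - th) / (4 * N%:R) * (S s / (1 - m ^+ 2) - N%:R) ^+ 2.
  by rewrite /beta; field; rewrite !gt_eqF.
by rewrite mulr_ge0 ?sqr_ge0// divr_ge0 ?mulr_ge0// ?subr_ge0.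
Qed.

Lemma mean_free_energy_le (th : R) : 0 < th <= 1 ->
  (mean_free_energy g beta m <= (th^-1 * ln (site_sum m th))%:E)%E.
Proof.
move=> th01; have /andP[th0 th1] := th01.
have n0 : 0 < N%:R :> R by rewrite ltr0n.
(* [c] bounds the expected fractional sum, so the ratio in [ln_sum_expR_le] has mean at most 1 and
   cancels the [- 1]. *)
set c := site_sum m th ^+ N.
have c0 : 0 < c by rewrite exprn_gt0// site_sum_gt0.
have cE : c = \sum_(s : {ffun 'I_N -> bool}) \prod_i expR (site_exponent m th (s i)).
  rewrite -(bigA_distr_bigA (fun (_ : 'I_N) b => expR (site_exponent m th b))).
  by rewrite prodr_const card_ord.
pose k := (N%:R * th * c)^-1.
have k0 : 0 < k by rewrite invr_gt0 !mulr_gt0.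
have -> : th^-1 * ln (site_sum m th) = k * c + (N%:R * th)^-1 * (ln c - 1).
  rewrite /c lnXn ?site_sum_gt0// -/c -mulr_natl /k.
  by field; rewrite !gt_eqF.
rewrite /mean_free_energy unlock.
have mexp s : measurable_fun setT (fun w => expR (th * log_gibbs s w)).
  by apply: measurableT_comp => //; exact: measurable_funM.
apply: (@integral_le_addr _ _ _ _ _
  (fun w => k * \sum_s expR (th * log_gibbs s w))).
- apply: measurable_funM => //; apply: measurableT_comp => //.
  under eq_fun do rewrite partition_functionE.
  by apply: measurable_sum => s; exact: measurableT_comp.
- by apply: measurable_funM => //; exact: measurable_sum.
- move=> w; apply: mulr_ge0; first exact: ltW.
  by apply: sumr_ge0 => s _; exact: expR_ge0.
- under eq_integral do rewrite EFinM -sumEFin.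
  rewrite ge0_integralZl//; last 3 first.
  + apply: emeasurable_sum => s; exact/measurable_EFinP.
  + by move=> w _; apply: sume_ge0 => s _; rewrite lee_fin expR_ge0.
  + by rewrite lee_fin ltW.
  rewrite EFinM lee_pmul2l// ?lte_fin// ge0_integral_sum//; last first.
    by move=> s; exact/measurable_EFinP.
  rewrite cE -sumEFin; apply: lee_sum => s _.
  by apply: moment_log_gibbs_le; rewrite (ltW th0).
- move=> w; rewrite partition_functionE.
  rewrite mulrC ler_pdivrMr//.
  apply: (le_trans (@ln_sum_expR_le _ _ [ffun=> true] (log_gibbs^~ w) th c th01 c0)).
  rewrite le_eqVlt; apply/orP; left; apply/eqP; rewrite /k.
  by field; rewrite !gt_eqF.
Qed.

End fixed_size.

End free_energy.

(** * Failure of the high temperature condition on the AT boundary *)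

Theorem theorem1 (R : realType) (d : measure_display) (T : measurableType d)
    (P : probability T R) (g : forall N : nat, 'I_N -> 'I_N -> {RV P >-> R})
    (hg : forall N : nat, gaussian_disorder (g N))
    (mstar : R) (hmstar : 0 < mstar < 1) (hI : binary_entropy mstar = 4^-1)
    (m : R) (hm : -1 < m < 1) (hmm : mstar < `|m|) :
  exists beta : R, AT m beta /\ ~ HT g m beta.
Proof.
have q0 : 0 < 1 - m ^+ 2 by move: hm => /andP[]; nra.
have /andP[mstar0 _] := hmstar.
have I4 : binary_entropy m < 4^-1.
  have m1 : `|m| < 1 by rewrite ltr_norml.
  have := @binary_entropy_decreasing _ _ _ mstar0 hmm m1.
  by rewrite hI; case: (ger0P m) => _; rewrite ?binary_entropyN.
have [th /andP[th0 th1] phi1] := @site_sum_lt1 _ _ hm I4.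
exists (1 - m ^+ 2)^-1; split.
  by split; [rewrite invr_ge0 ltW|rewrite -exprMn mulVf ?gt_eqF// expr1n].
move=> [_ lim0].
(* The upper bound is the same for all [N > 0], so a limit 0 would make it nonnegative, against
   [phi1]. *)
have : (0 <= (th^-1 * ln (site_sum m th))%:E)%E.
  apply: cvge_to_le lim0 _; near=> N.
  apply: mean_free_energy_le => //; last by rewrite th0 ltW.
  by near: N; exact: nbhs_infty_gt.
rewrite lee_fin pmulr_rge0 ?invr_gt0// leNgt => /negP; apply.
by rewrite ln_lt0// site_sum_gt0.
Unshelve. all: by end_near.
Qed.
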